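(* Let $n\geq 3$. The torsion of the quotient $B_n/[P_n,P_n]$ is equal to the odd torsion of the symmetric group $S_n$, that is, the set of orders of the finite-order elements of $B_n/[P_n,P_n]$ is equal to the set of odd integers that occur as orders of elements of $S_n$. Moreover, given an element $\theta\in S_n$ of odd order $r$, there exists $\beta\in B_n/[P_n,P_n]$ of order $r$ such that $\overline{\sigma}(\beta)=\theta$. So given any cyclic subgroup $H$ of $S_n$ of odd order $r$, there exists a finite-order subgroup $\widetilde{H}$ of $B_n/[P_n,P_n]$ such that $\overline{\sigma}(\widetilde{H})=H$.
   Context: $B_n$ is the Artin braid group with generators $\sigma_1,\ldots,\sigma_{n-1}$ and relations $\sigma_i\sigma_j=\sigma_j\sigma_i$ for $|i-j|\geq 2$, and $\sigma_{i+1}\sigma_i\sigma_{i+1}=\sigma_i\sigma_{i+1}\sigma_i$ for $1\leq i\leq n-2$. $S_n$ is the symmetric group, with permutations composed from left to right. $\sigma\colon B_n\to S_n$ is the homomorphism with $\sigma(\sigma_i)=(i,i+1)$, $P_n=\ker\sigma$ is the pure braid group, $[P_n,P_n]$ is its commutator subgroup, and $\overline{\sigma}\colon B_n/[P_n,P_n]\to S_n$ is the homomorphism induced by $\sigma$. *)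

(* Defs.v *)
From HB Require Import structures.
From mathcomp Require Import all_boot fingroup perm cyclic generic_quotient.
From mathcomp Require Import zify.
From mathcomp Require Import boolp classical_sets cardinality.

Set Implicit Arguments.
Unset Strict Implicit.
Unset Printing Implicit Defensive.

Local Open Scope group_scope.
Local Open Scope quotient_scope.

(* Groups here are possibly infinite: they are instances of [groupType] from  *)
(* mathcomp.boot.monoid, and subgroups are instances of its [groupClosed].    *)

HB.mixin Record isConjgClosed (G : groupType) (S : {pred G}) := {
  gpred_conjg : forall x y : G, x \in S -> x ^ y \in S
}.

#[short(type="normalClosed")]
HB.structure Definition NormalClosed (G : groupType) :=
  {S of GroupClosed G S & isConjgClosed G S}.

Section Quotient.
Variables (G : groupType) (N : normalClosed G).
Implicit Types x y z : G.

Definition coset_eq : rel G := fun x y => x^-1 * y \in N.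

Fact coset_eq_refl : reflexive coset_eq.
Proof. by move=> x; rewrite /coset_eq mulVg gpred1. Qed.

Fact coset_eq_sym : symmetric coset_eq.
Proof. by move=> x y; rewrite /coset_eq -gpredV invgM invgK. Qed.

Fact coset_eq_trans : transitive coset_eq.
Proof.
move=> y x z; rewrite /coset_eq => xy yz.
by have := gpredM _ _ xy yz; rewrite -mulgA mulKVg.
Qed.

Canonical coset_equiv :=
  EquivRel coset_eq coset_eq_refl coset_eq_sym coset_eq_trans.

Definition quot : Type := {eq_quot coset_eq}.
HB.instance Definition _ := Choice.on quot.
HB.instance Definition _ := EqQuotient.on quot.

Definition quot_mul (a b : quot) : quot := \pi_quot (repr a * repr b).
Definition quot_one : quot := \pi_quot 1.
Definition quot_inv (a : quot) : quot := \pi_quot (repr a)^-1.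

Lemma quot_eqP x y : reflect (\pi_quot x = \pi_quot y) (x^-1 * y \in N).
Proof. exact: (@eqquotP _ _ quot x y). Qed.

Lemma pi_quotM x y : \pi_quot (x * y) = quot_mul (\pi x) (\pi y).
Proof.
apply/quot_eqP; rewrite invgM.
have xP : x^-1 * repr (\pi_quot x) \in N by apply/quot_eqP; rewrite reprK.
have yP : y^-1 * repr (\pi_quot y) \in N by apply/quot_eqP; rewrite reprK.
have := gpredM _ _ (gpred_conjg _ y xP) yP.
by rewrite conjgE !mulgA mulgK.
Qed.

Lemma pi_quotV x : \pi_quot x^-1 = quot_inv (\pi x).
Proof.
apply/quot_eqP; rewrite invgK.
have : (repr (\pi_quot x))^-1 * x \in N by apply/quot_eqP; rewrite reprK.
by move/(gpred_conjg _ x^-1); rewrite conjgE invgK mulgK.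
Qed.

Fact quot_mulA : associative quot_mul.
Proof.
by elim/quotW=> x; elim/quotW=> y; elim/quotW=> z; rewrite -!pi_quotM mulgA.
Qed.
Fact quot_1mul : left_id quot_one quot_mul.
Proof. by elim/quotW=> x; rewrite -pi_quotM mul1g. Qed.
Fact quot_mul1 : right_id quot_one quot_mul.
Proof. by elim/quotW=> x; rewrite -pi_quotM mulg1. Qed.
Fact quot_Vmul : left_inverse quot_one quot_inv quot_mul.
Proof. by elim/quotW=> x; rewrite -pi_quotV -pi_quotM mulVg. Qed.
Fact quot_mulV : right_inverse quot_one quot_inv quot_mul.
Proof. by elim/quotW=> x; rewrite -pi_quotV -pi_quotM mulgV. Qed.

HB.instance Definition _ := isGroup.Build quot
  quot_mulA quot_1mul quot_mul1 quot_Vmul quot_mulV.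

End Quotient.

Section QuotientLift.
Variables (G H : groupType) (N : normalClosed G).
Variables (f : UMagmaMorphism.type G H) (fN : forall x, x \in N -> f x = 1).

Definition quot_lift of (forall x, x \in N -> f x = 1) : quot N -> H :=
  fun a => f (repr a).

Lemma quot_lift_pi x : quot_lift fN (\pi x) = f x.
Proof.
rewrite /quot_lift; apply: (mulgI (f x)^-1).
rewrite mulVg -gmulfV -gmulfM; apply: fN.
by apply/(@quot_eqP _ N); rewrite reprK.
Qed.

Fact quot_lift_morphism : monoid_morphism (quot_lift fN).
Proof.
split; first by rewrite -[1]/(\pi_(quot N) 1) quot_lift_pi gmulf1.
elim/quotW=> x; elim/quotW=> y.
rewrite -[_ * _]/(quot_mul _ _) -pi_quotM !quot_lift_pi; exact: gmulfM.
Qed.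

HB.instance Definition _ :=
  isUMagmaMorphism.Build (quot N) H (quot_lift fN) quot_lift_morphism.

End QuotientLift.

Section Kernel.
Variables (G H : groupType) (f : UMagmaMorphism.type G H).

Definition kernel : {pred G} := fun x => f x == 1.

Fact kernelM : mulg_closed kernel.
Proof.
move=> x y /eqP fx /eqP fy; apply/eqP.
by rewrite gmulfM fx fy mulg1.
Qed.
Fact kernel1 : 1 \in kernel.
Proof. by apply/eqP; rewrite gmulf1. Qed.
Fact kernelV : invg_closed kernel.
Proof. by move=> x /eqP fx; apply/eqP; rewrite gmulfV fx invg1. Qed.
Fact kernelJ x y : x \in kernel -> x ^ y \in kernel.
Proof. by move=> /eqP fx; apply/eqP; rewrite gmulfJ fx conj1g. Qed.

HB.instance Definition _ := isMulClosed.Build G kernel kernelM.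
HB.instance Definition _ := isMul1Closed.Build G kernel kernel1.
HB.instance Definition _ := isInvClosed.Build G kernel kernelV.
HB.instance Definition _ := isConjgClosed.Build G kernel kernelJ.

End Kernel.

Inductive generated (G : groupType) (S : set G) : G -> Prop :=
| generated_mem x : S x -> generated S x
| generated1 : generated S 1
| generatedM x y : generated S x -> generated S y -> generated S (x * y)
| generatedV x : generated S x -> generated S x^-1.

Section CommutatorSubgroup.
Variables (G : groupType) (N : normalClosed G).

Definition commutators : set G :=
  fun z => exists x y : G, [/\ x \in N, y \in N & z = [~ x, y]].

Definition commutator_subgroup : {pred G} :=
  fun z => `[< generated commutators z >].

Fact commutator_subgroupM : mulg_closed commutator_subgroup.
Proof. by move=> x y /asboolP gx /asboolP gy; apply/asboolP/generatedM. Qed.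
Fact commutator_subgroup1 : 1 \in commutator_subgroup.
Proof. exact/asboolP/generated1. Qed.
Fact commutator_subgroupV : invg_closed commutator_subgroup.
Proof. by move=> x /asboolP gx; apply/asboolP/generatedV. Qed.
Fact commutator_subgroupJ x y :
  x \in commutator_subgroup -> x ^ y \in commutator_subgroup.
Proof.
move=> /asboolP gx; apply/asboolP; elim: gx => {x}.
- move=> _ [x [z [xN zN ->]]]; apply: generated_mem.
  by exists (x ^ y), (z ^ y); rewrite conjRg; split=> //; apply: gpred_conjg.
- by rewrite conj1g; apply: generated1.
- by move=> x z _ gx _ gz; rewrite conjMg; apply: generatedM.
- by move=> x _ gx; rewrite conjVg; apply: generatedV.
Qed.

HB.instance Definition _ :=
  isMulClosed.Build G commutator_subgroup commutator_subgroupM.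
HB.instance Definition _ :=
  isMul1Closed.Build G commutator_subgroup commutator_subgroup1.
HB.instance Definition _ :=
  isInvClosed.Build G commutator_subgroup commutator_subgroupV.
HB.instance Definition _ :=
  isConjgClosed.Build G commutator_subgroup commutator_subgroupJ.

End CommutatorSubgroup.

(* The letter [(x, true)] stands for [x] and [(x, false)] for its inverse.    *)
Notation word X := (seq (X * bool)).

Section Presentation.
Variables (X : choiceType) (R : word X -> word X -> Prop).
Implicit Types u v w : word X.

Inductive word_eq : word X -> word X -> Prop :=
| word_eq_refl u : word_eq u u
| word_eq_sym u v : word_eq u v -> word_eq v u
| word_eq_trans v u w : word_eq u v -> word_eq v w -> word_eq u w
| word_eq_cat u u' v v' :
    word_eq u u' -> word_eq v v' -> word_eq (u ++ v) (u' ++ v')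
| word_eq_cancel x b : word_eq [:: (x, b); (x, ~~ b)] [::]
| word_eq_rel u v : R u v -> word_eq u v.

Definition word_eqb : rel (word X) := fun u v => `[< word_eq u v >].

Fact word_eqb_refl : reflexive word_eqb.
Proof. by move=> u; apply/asboolP/word_eq_refl. Qed.
Fact word_eqb_sym : symmetric word_eqb.
Proof. by move=> u v; apply/asboolP/asboolP; apply: word_eq_sym. Qed.
Fact word_eqb_trans : transitive word_eqb.
Proof.
by move=> v u w /asboolP uv /asboolP vw; apply/asboolP/(word_eq_trans uv vw).
Qed.

Canonical word_equiv :=
  EquivRel word_eqb word_eqb_refl word_eqb_sym word_eqb_trans.

Definition presented : Type := {eq_quot word_eqb}.
HB.instance Definition _ := Choice.on presented.
HB.instance Definition _ := EqQuotient.on presented.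

Definition word_inv (u : word X) : word X :=
  rev [seq (p.1, ~~ p.2) | p <- u].

Definition pres_mul (a b : presented) : presented :=
  \pi_presented (repr a ++ repr b).
Definition pres_one : presented := \pi_presented [::].
Definition pres_inv (a : presented) : presented :=
  \pi_presented (word_inv (repr a)).
Definition pres_gen (x : X) : presented := \pi_presented [:: (x, true)].

Lemma pres_eqP u v : \pi_presented u = \pi_presented v <-> word_eq u v.
Proof.
split=> [/(@eqquotP _ _ presented)/asboolP //|uv].
exact/(@eqquotP _ _ presented)/asboolP.
Qed.

Lemma word_inv_cat u v : word_inv (u ++ v) = word_inv v ++ word_inv u.
Proof. by rewrite /word_inv map_cat rev_cat. Qed.

Lemma word_invK : involutive word_inv.
Proof.
move=> u; rewrite /word_inv map_rev revK -map_comp -[RHS]map_id.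
by apply: eq_map => -[x b] /=; rewrite negbK.
Qed.

Lemma word_eq_mulV u : word_eq (u ++ word_inv u) [::].
Proof.
elim: u => [|[x b] u IHu]; first exact: word_eq_refl.
rewrite -[_ :: u]/([:: (x, b)] ++ u) word_inv_cat -catA (catA u).
apply: (word_eq_trans (v := [:: (x, b)] ++ [::] ++ word_inv [:: (x, b)])).
  apply: word_eq_cat; first exact: word_eq_refl.
  by apply: word_eq_cat => //; apply: word_eq_refl.
exact: word_eq_cancel.
Qed.

Lemma word_eq_Vmul u : word_eq (word_inv u ++ u) [::].
Proof. by have := word_eq_mulV (word_inv u); rewrite word_invK. Qed.

Lemma word_eq_inv u v : word_eq u v -> word_eq (word_inv u) (word_inv v).
Proof.
move=> uv; rewrite -[word_inv u]cats0.
apply: (word_eq_trans (v := word_inv u ++ (v ++ word_inv v))).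
  apply: word_eq_cat (word_eq_refl _) _.
  exact/word_eq_sym/word_eq_mulV.
rewrite catA -[X in word_eq _ X]cat0s; apply: word_eq_cat (word_eq_refl _).
apply: word_eq_trans (word_eq_Vmul u).
exact/word_eq_cat/word_eq_sym/uv/word_eq_refl.
Qed.

Lemma word_eq_repr u : word_eq u (repr (\pi_presented u)).
Proof. by apply/pres_eqP; rewrite reprK. Qed.

Lemma pi_presM u v : \pi_presented (u ++ v) = pres_mul (\pi u) (\pi v).
Proof. by apply/pres_eqP/word_eq_cat; apply: word_eq_repr. Qed.

Lemma pi_presV u : \pi_presented (word_inv u) = pres_inv (\pi u).
Proof. exact/pres_eqP/word_eq_inv/word_eq_repr. Qed.

Fact pres_mulA : associative pres_mul.
Proof.
by elim/quotW=> x; elim/quotW=> y; elim/quotW=> z; rewrite -!pi_presM catA.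
Qed.
Fact pres_1mul : left_id pres_one pres_mul.
Proof. by elim/quotW=> x; rewrite -pi_presM. Qed.
Fact pres_mul1 : right_id pres_one pres_mul.
Proof. by elim/quotW=> x; rewrite -pi_presM cats0. Qed.
Fact pres_Vmul : left_inverse pres_one pres_inv pres_mul.
Proof.
by elim/quotW=> x; rewrite -pi_presV -pi_presM; apply/pres_eqP/word_eq_Vmul.
Qed.
Fact pres_mulV : right_inverse pres_one pres_inv pres_mul.
Proof.
by elim/quotW=> x; rewrite -pi_presV -pi_presM; apply/pres_eqP/word_eq_mulV.
Qed.

HB.instance Definition _ := isGroup.Build presented
  pres_mulA pres_1mul pres_mul1 pres_Vmul pres_mulV.

End Presentation.

Definition word_eval (X : Type) (H : groupType) (f : X -> H) (u : word X) : H :=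
  \prod_(p <- u) (if p.2 then f p.1 else (f p.1)^-1).

Section PresentationLift.
Variables (X : choiceType) (R : word X -> word X -> Prop).
Variables (H : groupType) (f : X -> H).
Hypothesis fR : forall u v, R u v -> word_eval f u = word_eval f v.

Definition pres_lift of (forall u v, R u v -> word_eval f u = word_eval f v) :
    presented R -> H :=
  fun a => word_eval f (repr a).

Lemma word_eval_cat u v :
  word_eval f (u ++ v) = word_eval f u * word_eval f v.
Proof. exact: big_cat. Qed.

Lemma word_eval_eq u v : word_eq R u v -> word_eval f u = word_eval f v.
Proof.
elim=> {u v} //; first by move=> v u w _ -> _ ->.
- by move=> u u' v v' _ uu' _ vv'; rewrite !word_eval_cat uu' vv'.
by move=> x [] /=; rewrite /word_eval !big_cons big_nil /= mulg1 ?mulgV ?mulVg.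
Qed.

Lemma pres_lift_pi u : pres_lift fR (\pi u) = word_eval f u.
Proof. exact/esym/word_eval_eq/word_eq_repr. Qed.

Lemma pres_lift_gen x : pres_lift fR (pres_gen R x) = f x.
Proof. by rewrite pres_lift_pi /word_eval big_seq1. Qed.

Fact pres_lift_morphism : monoid_morphism (pres_lift fR).
Proof.
split; first by rewrite -[1]/(\pi_(presented R) [::]) pres_lift_pi /word_eval big_nil.
elim/quotW=> u; elim/quotW=> v.
by rewrite -[_ * _]/(pres_mul _ _) -pi_presM !pres_lift_pi word_eval_cat.
Qed.

HB.instance Definition _ :=
  isUMagmaMorphism.Build (presented R) H (pres_lift fR) pres_lift_morphism.

End PresentationLift.

(* [i : 'I_n.-1] indexes the generator crossing the strands [i] and [i.+1] of *)
(* ['I_n], that is, the (i+1)-st Artin generator in the usual 1-based         *)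
(* numbering.                                                                 *)
Section Braids.
Variable n : nat.

Inductive braid_rel : word 'I_n.-1 -> word 'I_n.-1 -> Prop :=
| braid_rel_comm (i j : 'I_n.-1) : (i.+2 <= j) || (j.+2 <= i) ->
    braid_rel [:: (i, true); (j, true)] [:: (j, true); (i, true)]
| braid_rel_braid (i j : 'I_n.-1) : j = i.+1 :> nat ->
    braid_rel [:: (j, true); (i, true); (j, true)]
              [:: (i, true); (j, true); (i, true)].

Definition braid_group : groupType := presented braid_rel.

Definition artin_gen (i : 'I_n.-1) : braid_group := pres_gen braid_rel i.

Fact strand_subproof (i : 'I_n.-1) : (i < n) && (i.+1 < n).
Proof. by case: n i => [|m] [i /= im]; rewrite ?ltnS ?im ?(ltnW im). Qed.

Definition left_strand (i : 'I_n.-1) : 'I_n :=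
  Ordinal (proj1 (andP (strand_subproof i))).
Definition right_strand (i : 'I_n.-1) : 'I_n :=
  Ordinal (proj2 (andP (strand_subproof i))).

Definition adjacent_transposition (i : 'I_n.-1) : 'S_n :=
  tperm (left_strand i) (right_strand i).

Fact adjacent_transposition_rel u v : braid_rel u v ->
  word_eval adjacent_transposition u = word_eval adjacent_transposition v.
Proof.
have tJ (s t : 'S_n) : s^-1 = s -> s * (t * s) = t ^ s.
  by move=> sV; rewrite /conjg sV.
case=> i j ij; rewrite /word_eval !big_cons big_nil /= !mulg1.
  rewrite [LHS]conjgC tpermJ; congr (_ * tperm _ _).
    by rewrite tpermD // -val_eqE /=; lia.
  by rewrite tpermD // -val_eqE /=; lia.
have eq_ij : left_strand j = right_strand i by apply: val_inj.
have lt_ij : left_strand i < right_strand j by rewrite /= ij ltnW.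
have li : left_strand i != right_strand i by rewrite -val_eqE /= ltn_eqF.
have lj : right_strand i != right_strand j by rewrite -val_eqE /= ij ltn_eqF.
have lij : left_strand i != right_strand j.
  by rewrite -val_eqE ltn_eqF.
rewrite !tJ ?tpermV // !tpermJ /adjacent_transposition eq_ij tpermL tpermR.
by congr tperm; rewrite tpermD // eq_sym.
Qed.

(* The product of ['S_n] applies its left factor first.                       *)
Definition sigma : UMagmaMorphism.type braid_group 'S_n :=
  pres_lift adjacent_transposition_rel.

Lemma sigma_gen i : sigma (artin_gen i) = adjacent_transposition i.
Proof. exact: pres_lift_gen. Qed.

Definition pure_braid : normalClosed braid_group := kernel sigma.

Definition braid_mod_comm : groupType := quot (commutator_subgroup pure_braid).

Fact sigma_comm x : x \in commutator_subgroup pure_braid -> sigma x = 1.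
Proof.
move/asboolP=> gx; apply/eqP; rewrite -[_ == 1]/(x \in pure_braid).
elim: gx => {x} [_ [x [y [xP yP ->]]]| |x y _ xP _ yP|x _ xP].
- exact: gpredR.
- exact: gpred1.
- exact: gpredM.
- exact: gpredVr.
Qed.

Definition sigma_bar : UMagmaMorphism.type braid_mod_comm 'S_n :=
  quot_lift sigma_comm.

Lemma sigma_bar_pi (x : braid_group) :
  sigma_bar (\pi_(quot (commutator_subgroup pure_braid)) x) = sigma x.
Proof. exact: quot_lift_pi. Qed.

End Braids.

Definition has_order (G : groupType) (x : G) (r : nat) : Prop :=
  [/\ 0 < r, x ^+ r = 1 & forall m, 0 < m < r -> x ^+ m <> 1].

Definition torsion_orders (G : groupType) : set nat :=
  [set r | exists x : G, has_order x r]%classic.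

(* Main.v *)
(* Let K = P_n / [P_n, P_n], an abelian normal subgroup of the quotient G.    *)
(* For a braid x, let [wind x i j] be the number of signed crossings of the   *)
(* strands starting at i and j: it is a cocycle over sigma, it is symmetric   *)
(* in i and j, and it is odd exactly when x inverts the order of i and j.     *)
(*                                                                            *)
(* K is generated by the classes of the A_ij, because conjugation by an Artin *)
(* generator permutes them and modulo the A_ij the Artin generators satisfy   *)
(* the Coxeter relations of S_n. As [wind] is 2 at {i, j} and 0 elsewhere on  *)
(* A_ij, an element of K without winding is trivial. So K is torsion-free,    *)
(* whence orders are preserved by sigma_bar; and if x^2 = 1 and sigma_bar x   *)
(* swaps i and j, then 0 = [wind (x^2) i j] = 2 [wind x i j] contradicts      *)
(* parity.                                                                    *)
(*                                                                            *)
(* If theta has odd order, no power of it swaps two points, so unordered      *)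
(* pairs have a theta-invariant orientation. Let f {i, j} be 1 if the         *)
(* orientation of {i, j} is increasing, and 0 otherwise. The coboundary       *)
(* f {theta i, theta j} - f {i, j} has the parity of a lift of theta, hence   *)
(* it is the winding of one, and the winding of its powers telescopes.        *)
Require Import Defs.
From HB Require Import structures.
From mathcomp Require Import all_boot fingroup perm cyclic generic_quotient.
From mathcomp Require Import boolp classical_sets cardinality.
From mathcomp Require Import ssralg ssrnum ssrint intdiv zify.

Set Implicit Arguments.
Unset Strict Implicit.
Unset Printing Implicit Defensive.

Local Open Scope group_scope.

(** Signed crossing numbers of pairs of strands form a homomorphism [crossings] to a semidirect
    product, and this homomorphism detects every element of the abelian kernel of [sigma_bar]
    ([wind_faithful]). Indeed the pair generators span the kernel ([pure_in_span], which rests on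
    the Coxeter presentation through [coxeter_faithful]), and [wind] reads off twice the
    coefficients of a combination of them ([wind_pure_comb]).

    Hence the kernel is torsion-free and [sigma_bar] preserves finite orders
    ([has_order_sigma_bar]), while [wind_parity] excludes even orders ([has_order_odd]). Conversely,
    the windings of a lift of theta can be adjusted by arbitrary even amounts on pairs. For theta of
    odd order they can be made a coboundary, and such a lift has the order of theta
    ([odd_order_lift]). The powers of this lift cover the cyclic group generated by theta. *)

Definition swap (k x : nat) : nat :=
  if x == k then k.+1 else if x == k.+1 then k else x.

(** * The Coxeter presentation of the symmetric group *)

Section Coxeter.
Variables (H : groupType) (n : nat) (t : nat -> H).
Hypothesis t_sq : forall i, i < n.-1 -> t i * t i = 1.
Hypothesis t_comm : forall i j, i.+1 < j -> t i * t j = t j * t i.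
Hypothesis t_braid : forall i, i.+1 < n.-1 ->
  t i.+1 * t i * t i.+1 = t i * t i.+1 * t i.

Let ev (u : seq nat) : H := \prod_(k <- u) t k.
(* [run k d] is the descending product t_(k+d-1) ... t_k. The [run k (m.+1 - k)]
   represent the cosets of <t_0, ..., t_(m-1)> in <t_0, ..., t_m>. *)
Let run k d := ev (rev (iota k d)).

Let ev_rcons u k : ev (rcons u k) = ev u * t k.
Proof. by rewrite /ev -cats1 big_cat big_seq1. Qed.

Let run0 k : run k 0 = 1.
Proof. exact: big_nil. Qed.

Let runS k d : run k d.+1 = run k.+1 d * t k.
Proof. by rewrite /run /= rev_cons ev_rcons. Qed.

Let runD k a b : run k (a + b) = run (k + a) b * run k a.
Proof. by rewrite /run iotaD rev_cat /ev big_cat. Qed.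

Let t_commW i j : (i.+1 < j) || (j.+1 < i) -> commute (t i) (t j).
Proof. by case/orP=> ij; [| symmetry]; apply: t_comm. Qed.

Let run_comm j k d : (j.+1 < k) || (k + d < j) -> commute (t j) (run k d).
Proof.
move=> jk; rewrite /run /ev; elim: d k jk => [|d IHd] k jk.
  by rewrite big_nil; apply: commute1.
rewrite /= rev_cons -cats1 big_cat big_seq1; apply: commuteM.
  by apply: IHd; lia.
by apply: t_commW; lia.
Qed.

Let run_slide j k d : k <= j -> j.+1 < k + d <= n.-1 ->
  run k d * t j.+1 = t j * run k d.
Proof.
(* The run splits as [b * (t j.+1 * t j) * a]. The incoming [t j.+1] commutes past [a], the braid
   relation applies, and the resulting [t j] commutes past [b]. *)
move=> kj jd; have -> : d = (j - k) + (2 + (k + d - j.+2)) by lia.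
rewrite !runD; have -> : k + (j - k) = j by lia.
rewrite runS (runS _ 0) run0 mul1g.
set b := run _ _; set a := run _ _.
have ca : t j.+1 * a = a * t j.+1 by apply: run_comm; lia.
have cb : t j * b = b * t j by apply: run_comm; lia.
by rewrite -(mulgA _ a) -ca !mulgA cb -2!(mulgA b) t_braid ?mulgA; last lia.
Qed.

(** Appending [t j] to a run ending in [t k] keeps the form: it commutes past the run when
    [j.+1 < k], lengthens it when [j.+1 = k], cancels its last factor when [j = k], and slides
    through as [t j.-1] when [k < j]. *)
Lemma coxeter_coset m (u : seq nat) : m < n.-1 -> all (ltn^~ m.+1) u ->
  exists (v : seq nat) k, [/\ all (ltn^~ m) v, k <= m.+1
    & ev u = ev v * run k (m.+1 - k)].
Proof.
move=> mn; elim/last_ind: u => [_|u j IHu].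
  by exists [::], m.+1; rewrite subnn run0 mulg1.
rewrite all_rcons => /andP[/= jm /IHu[v [k [vm km uE]]]]; rewrite ev_rcons uE.
have [jk | kj | jE] := ltngtP j k.
- have [jk1 | jk1] := leqP k j.+1.
    have kE : k = j.+1 by lia.
    exists v, j; split=> //; first by lia.
    by rewrite kE subSS subSn ?runS ?mulgA //; lia.
  exists (rcons v j), k; rewrite all_rcons vm ev_rcons; split=> //; first by lia.
  by rewrite -!mulgA (run_comm (j := j)) // jk1.
- case: j kj jm => // j kj jm.
  exists (rcons v j), k; rewrite all_rcons vm ev_rcons; split=> //; first by lia.
  by rewrite -!mulgA run_slide //; lia.
- rewrite jE in jm *; exists v, k.+1; split=> //.
  have -> : (m.+1 - k = (m.+1 - k.+1).+1)%N by lia.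
  by rewrite runS -!mulgA t_sq ?mulg1 //; lia.
Qed.

Variable f : UMagmaMorphism.type H 'S_n.
Hypothesis f_swap : forall k (x : 'I_n), k < n.-1 -> f (t k) x = swap k x :> nat.

Let fM x y i : f (x * y) i = f y (f x i).
Proof. by rewrite gmulfM permM. Qed.

Let f_above m v (i : 'I_n) : m < n.-1 -> all (ltn^~ m) v -> m < i ->
  f (ev v) i = i.
Proof.
move=> mn; elim/last_ind: v => [_|v j IHv] mi.
  by rewrite /ev big_nil gmulf1 perm1.
move: mi; rewrite all_rcons => /andP[/= jm vm] mi.
rewrite ev_rcons fM IHv //; apply: val_inj => /=.
rewrite f_swap /swap; last by lia.
by case: ifP; [lia|case: ifP; lia].
Qed.

Let f_run k d (i : 'I_n) : i = (k + d)%N :> nat ->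
  f (run k d) i = k :> nat.
Proof.
elim: d k i => [|d IHd] k i iE; first by rewrite run0 gmulf1 perm1 iE addn0.
have i_n := ltn_ord i.
rewrite runS fM f_swap; last by lia.
by rewrite IHd /swap ?iE ?addSnnS // eqxx; case: eqP => //; lia.
Qed.

Lemma coxeter_faithful (u : seq nat) :
  all (ltn^~ n.-1) u -> f (\prod_(k <- u) t k) = 1 -> \prod_(k <- u) t k = 1.
Proof.
suff main m v : m <= n.-1 -> all (ltn^~ m) v ->
    (forall i : 'I_n, i <= m -> f (ev v) i = i) -> ev v = 1.
  by move=> un fu; apply: (main n.-1) => // i _; rewrite /ev fu perm1.
elim: m v => [|m IHm] v mn.
  by case: v => // _ _; rewrite /ev big_nil.
move=> /(coxeter_coset mn)[v' [k [v'm km vE]]] fv.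
have m1n : m.+1 < n by lia.
(* The letters of [v'] are below [m], so [v'] fixes the point [m.+1], and the run carries that point
   to [k]. As the whole word fixes it, [k = m.+1] and the run is empty. *)
have := fv (Ordinal m1n) (leqnn _).
rewrite vE fM (f_above (m := m)) //.
move/(congr1 val) => /=; rewrite f_run /= ?subnKC // => kE.
rewrite kE subnn run0 mulg1 in vE *.
apply: IHm => //; first by lia.
by move=> i im; rewrite -vE fv //; lia.
Qed.

End Coxeter.

(** * Crossing numbers as a homomorphism to a semidirect product *)

Lemma adjacent_transpositionE n (k : 'I_n.-1) (x : 'I_n) :
  adjacent_transposition k x = swap k x :> nat.
Proof.
rewrite /adjacent_transposition /swap.
case: tpermP => [->|->|/eqP xl /eqP xr] /=.
- by rewrite eqxx.
- by rewrite eqxx gtn_eqF.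
- by rewrite -!val_eqE /= in xl xr; rewrite (negPf xl) (negPf xr).
Qed.

Definition crossing (k x y : nat) : nat :=
  ((x == k) && (y == k.+1)) || ((x == k.+1) && (y == k)).

(* Equations with a conditional on the left wait until it is resolved.       *)
Ltac split_eqs :=
  repeat match goal with |- context [?a == ?b] =>
    lazymatch type of a with nat => idtac end;
    lazymatch a with context [if _ then _ else _] => fail | _ => idtac end;
    let e := fresh in have [e|e] := boolP (a == b); try (exfalso; lia);
      rewrite /= ?eqxx ?e ?(negPf e) /= end.

(** Together with [crossing_braid], this makes the crossing count, transported along the strands,
    respect the braid relations. *)
Lemma crossing_comm i j x y : (i.+1 < j) || (j.+1 < i) ->
  crossing i x y + crossing j (swap i x) (swap i y) =
  crossing j x y + crossing i (swap j x) (swap j y).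
Proof.
by move=> ij; rewrite /crossing /swap; split_eqs; lia.
Qed.

Lemma crossing_braid i x y :
  crossing i.+1 x y + (crossing i (swap i.+1 x) (swap i.+1 y) +
  crossing i.+1 (swap i (swap i.+1 x)) (swap i (swap i.+1 y))) =
  crossing i x y + (crossing i.+1 (swap i x) (swap i y) +
  crossing i (swap i.+1 (swap i x)) (swap i.+1 (swap i y))).
Proof. by rewrite /crossing /swap; split_eqs; lia. Qed.

Section CrossingGroup.
Variable n : nat.

(* The semidirect product of the integer functions on ordered pairs of strands
   with ['S_n]; as in ['S_n], the left factor acts first. *)
Definition crossing_group : Type := ({ffun 'I_n * 'I_n -> int} * 'S_n)%type.
HB.instance Definition _ := Choice.on crossing_group.
Implicit Types (x y : braid_mod_comm n).

Definition crossing_mul (x y : crossing_group) : crossing_group :=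
  ([ffun p => (x.1 p + y.1 (x.2 p.1, x.2 p.2))%R], x.2 * y.2).
Definition crossing_one : crossing_group := ([ffun=> 0%R], 1).
Definition crossing_inv (x : crossing_group) : crossing_group :=
  ([ffun p => (- x.1 (x.2^-1 p.1, x.2^-1 p.2)%g)%R], x.2^-1).

Fact crossing_mulA : associative crossing_mul.
Proof.
move=> x y z; congr pair; last exact: mulgA.
by apply/ffunP=> p; rewrite !ffunE /= !permM GRing.addrA.
Qed.
Fact crossing_1mul : left_id crossing_one crossing_mul.
Proof.
case=> v s; congr pair; last exact: mul1g.
by apply/ffunP=> -[i j]; rewrite !ffunE /= !perm1 GRing.add0r.
Qed.
Fact crossing_mul1 : right_id crossing_one crossing_mul.
Proof.
case=> v s; congr pair; last exact: mulg1.
by apply/ffunP=> p; rewrite !ffunE GRing.addr0.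
Qed.
Fact crossing_Vmul : left_inverse crossing_one crossing_inv crossing_mul.
Proof.
move=> x; congr pair; last exact: mulVg.
by apply/ffunP=> p; rewrite !ffunE GRing.addNr.
Qed.
Fact crossing_mulV : right_inverse crossing_one crossing_inv crossing_mul.
Proof.
move=> x; congr pair; last exact: mulgV.
by apply/ffunP=> -[i j]; rewrite !ffunE /= !permK GRing.addrN.
Qed.

HB.instance Definition _ := isGroup.Build crossing_group
  crossing_mulA crossing_1mul crossing_mul1 crossing_Vmul crossing_mulV.

Definition crossing_perm (x : crossing_group) : 'S_n := x.2.
Fact crossing_perm_morphism : monoid_morphism crossing_perm.
Proof. by split. Qed.
HB.instance Definition _ := isUMagmaMorphism.Build crossing_group 'S_n
  crossing_perm crossing_perm_morphism.

Definition crossing_gen (k : 'I_n.-1) : crossing_group :=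
  ([ffun p : 'I_n * 'I_n => (crossing k p.1 p.2)%:Z%R], adjacent_transposition k).

Fact crossing_gen_rel u v : braid_rel u v ->
  word_eval crossing_gen u = word_eval crossing_gen v.
Proof.
move=> uv; have := adjacent_transposition_rel uv.
case: u v / uv => [i j ij|i j ij];
  rewrite /word_eval !big_cons !big_nil /= !mulg1 => pE; congr pair => //;
  apply/ffunP=> -[x y]; rewrite !ffunE /= ?permM !adjacent_transpositionE -!PoszD.
  by rewrite crossing_comm.
by rewrite ij crossing_braid.
Qed.

Definition braid_crossing : UMagmaMorphism.type (braid_group n) crossing_group :=
  pres_lift crossing_gen_rel.

Lemma braid_crossing_perm b : crossing_perm (braid_crossing b) = sigma n b.
Proof.
elim/quotW: b => u.
rewrite /braid_crossing /sigma /= !pres_lift_pi /word_eval gmulf_prod.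
by apply: eq_bigr => -[k []] _ //=; rewrite gmulfV.
Qed.

(** Over the identity permutation the semidirect product is the additive group of functions, so
    commutators of pure braids become trivial. *)
Fact braid_crossing_comm b :
  b \in commutator_subgroup (pure_braid n) -> braid_crossing b = 1.
Proof.
have pureP c : c \in pure_braid n -> (braid_crossing c).2 = 1.
  by move/eqP=> <-; rewrite -braid_crossing_perm.
have commM (x y : crossing_group) : x.2 = 1 -> y.2 = 1 -> commute x y.
  move=> x1 y1; congr pair; last by rewrite x1 y1.
  by apply/ffunP=> -[i j]; rewrite !ffunE x1 y1 /= !perm1 GRing.addrC.
move/asboolP; elim=> {b} [_ [x [y [xP yP ->]]]| |x y _ xP _ yP|x _ xP].
- by rewrite gmulfR; apply/eqP/commgP/commM; apply: pureP.
- exact: gmulf1.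
- by rewrite gmulfM xP yP mulg1.
- by rewrite gmulfV xP invg1.
Qed.

Definition crossings : UMagmaMorphism.type (braid_mod_comm n) crossing_group :=
  quot_lift braid_crossing_comm.

Lemma crossings_perm x : (crossings x).2 = sigma_bar n x.
Proof.
elim/quotW: x => b.
rewrite sigma_bar_pi -braid_crossing_perm; congr snd.
exact: (quot_lift_pi braid_crossing_comm b).
Qed.

Definition wind (x : braid_mod_comm n) (i j : 'I_n) : int := (crossings x).1 (i, j).

Lemma wind1 i j : wind 1 i j = 0%R.
Proof. by rewrite /wind gmulf1 ffunE. Qed.

Lemma windM x y i j :
  wind (x * y) i j = (wind x i j + wind y (sigma_bar n x i) (sigma_bar n x j))%R.
Proof. by rewrite /wind gmulfM ffunE -crossings_perm. Qed.

End CrossingGroup.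

(** * Generators and winding numbers in the quotient group *)

Section BraidModComm.
Variable n : nat.
Local Notation G := (braid_mod_comm n).
Local Notation piG := (\pi_(quot (commutator_subgroup (pure_braid n)))%qT).
Local Notation piW := (\pi_(presented (@braid_rel n)))%qT.
Implicit Types (x y z : G) (i j k : nat).

Lemma braid_piM (a b : braid_group n) : piG (a * b) = piG a * piG b.
Proof. exact: pi_quotM. Qed.

Lemma braid_piV (a : braid_group n) : piG a^-1 = (piG a)^-1.
Proof. exact: pi_quotV. Qed.

(* The index is 0-based; the value is the junk 1 for [k >= n.-1]. *)
Definition braid_gen k : G :=
  if insub k is Some i then piG (artin_gen (i : 'I_n.-1)) else 1.

Local Notation gen := braid_gen.

Lemma gen_ord (i : 'I_n.-1) : gen i = piG (artin_gen i).
Proof. by rewrite /braid_gen valK. Qed.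

Lemma gen_ind (P : G -> Prop) :
  P 1 -> (forall k, k < n.-1 -> P (gen k)) ->
  (forall x y, P x -> P y -> P (x * y)) -> (forall x, P x -> P x^-1) ->
  forall x, P x.
Proof.
move=> P1 Pg PM PV; elim/quotW=> b; elim/quotW: b; elim=> [|[i c] u IHu].
  exact: P1.
have -> : piW ((i, c) :: u) = piW [:: (i, c)] * piW u.
  exact: (pi_presM _ [:: (i, c)] u).
rewrite braid_piM; apply: PM => //.
have := Pg _ (ltn_ord i); rewrite gen_ord; case: c => //.
move/PV; rewrite -braid_piV; congr P; congr (piG _).
exact/esym/(pi_presV _ [:: (i, true)]).
Qed.

Lemma gen_comm i j : i.+1 < j -> gen i * gen j = gen j * gen i.
Proof.
move=> ij; rewrite /braid_gen.
case: insubP => [a _ ai|_]; case: insubP => [b _ bj|_]; rewrite ?mul1g ?mulg1 //.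
rewrite -!braid_piM; congr (piG _).
rewrite /artin_gen /pres_gen.
rewrite -[LHS](pi_presM _ [:: _] [:: _]) -[RHS](pi_presM _ [:: _] [:: _]).
by apply/pres_eqP/word_eq_rel/braid_rel_comm; rewrite ai bj ij.
Qed.

Lemma gen_braid i : i.+1 < n.-1 ->
  gen i.+1 * gen i * gen i.+1 = gen i * gen i.+1 * gen i.
Proof.
move=> i1n; have i0n := ltnW i1n.
rewrite (gen_ord (Ordinal i1n)) (gen_ord (Ordinal i0n)).
have piG3 a b c : piG (artin_gen a) * piG (artin_gen b) * piG (artin_gen c) =
    piG (piW [:: (a, true); (b, true); (c, true)]).
  rewrite -[[:: _; _; _]]/(([:: (a, true)] ++ [:: (b, true)]) ++ [:: (c, true)]).
  rewrite (pi_presM _ (_ ++ _)) (pi_presM _ [:: _]).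
  exact/esym/(etrans (braid_piM _ _))/(congr1 (mul^~ _))/braid_piM.
rewrite !piG3; congr (piG _).
exact/pres_eqP/word_eq_rel/braid_rel_braid.
Qed.

Lemma sigma_gen_swap k (p : 'I_n) : k < n.-1 -> sigma_bar n (gen k) p = swap k p :> nat.
Proof.
move=> kn; rewrite (gen_ord (Ordinal kn)) sigma_bar_pi sigma_gen.
exact: adjacent_transpositionE.
Qed.

Lemma wind_gen k (p q : 'I_n) : k < n.-1 -> wind (gen k) p q = crossing k p q.
Proof.
move=> kn; rewrite (gen_ord (Ordinal kn)) /wind.
rewrite [crossings n _](quot_lift_pi (@braid_crossing_comm n)).
by rewrite /braid_crossing /= pres_lift_gen /= ffunE.
Qed.

Lemma windV x p q :
  wind x^-1 p q = (- wind x (sigma_bar n x^-1 p)%g (sigma_bar n x^-1 q)%g)%R.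
Proof.
have := windM x^-1 x p q; rewrite mulVg wind1 => /esym/eqP.
by rewrite GRing.addr_eq0 => /eqP.
Qed.

Lemma wind_sym x p q : wind x p q = wind x q p.
Proof.
elim/gen_ind: x p q => [|k kn|x y IHx IHy|x IHx] p q.
- by rewrite !wind1.
- by rewrite !wind_gen // /crossing orbC andbC [X in _ || X]andbC.
- by rewrite !windM IHx IHy.
- by rewrite !windV IHx.
Qed.

Lemma wind_diag x p : wind x p p = 0%R.
Proof.
elim/gen_ind: x p => [|k kn|x y IHx IHy|x IHx] p.
- by rewrite !wind1.
- by rewrite !wind_gen // /crossing; lia.
- by rewrite !windM IHx IHy.
- by rewrite !windV IHx.
Qed.

(** A generator reverses the order of two strands exactly when it crosses them; the cocycle rule
    extends this to products and inverses. *)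
Lemma wind_parity x (p q : 'I_n) : p != q ->
  (2 %| wind x p q)%Z = ((p < q) == (sigma_bar n x p < sigma_bar n x q)).
Proof.
elim/gen_ind: x p q => [|k kn|x y IHx IHy|x IHx] p q pq.
- by rewrite wind1 gmulf1 !perm1 eqxx.
- rewrite wind_gen // !sigma_gen_swap //.
  have {pq} : p != q :> nat by [].
  move: (p : nat) (q : nat) => {}p {}q pq; rewrite /crossing /swap.
  split_eqs; lia.
- have := IHx p q pq; rewrite windM gmulfM !permM.
  have /IHy : sigma_bar n x p != sigma_bar n x q by rewrite (inj_eq perm_inj).
  by do 3 case: (_ < _) => /=; lia.
- rewrite windV; have := IHx (sigma_bar n x^-1 p) (sigma_bar n x^-1 q).
  rewrite (inj_eq perm_inj) => /(_ pq); rewrite gmulfV !permKV.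
  by do 2 case: (_ < _) => /=; lia.
Qed.

Lemma pure_commute x y : sigma_bar n x = 1 -> sigma_bar n y = 1 -> commute x y.
Proof.
elim/quotW: x => a; elim/quotW: y => b; rewrite !sigma_bar_pi => aP bP.
rewrite /commute -!braid_piM; apply/quot_eqP.
rewrite invgM -mulgA; apply/asboolP/generated_mem.
by exists b, a; split=> //; apply/eqP.
Qed.
End BraidModComm.

(** * Conjugation of the pure braid generators modulo commutators *)

Section PureGenerators.
Variable n : nat.
Local Notation G := (braid_mod_comm n).
Local Notation gen := (braid_gen n).
Implicit Types (x y z : G) (i j k : nat).

Lemma swapK k : involutive (swap k).
Proof. by move=> p; rewrite /swap; split_eqs; lia. Qed.

Lemma sigma_gen_sq k : sigma_bar n (gen k) * sigma_bar n (gen k) = 1.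
Proof.
have [kn | kn] := ltnP k n.-1; last first.
  by rewrite /braid_gen insubF ?gmulf1 ?mulg1 // ltnNge kn.
by apply/permP=> p; apply: val_inj; rewrite permM perm1 /= !sigma_gen_swap // swapK.
Qed.

Lemma sigma_genV k : (sigma_bar n (gen k))^-1 = sigma_bar n (gen k).
Proof. exact: mulg1_eq (sigma_gen_sq k). Qed.

(** The square of a generator is pure, hence centralises pure elements. *)
Lemma pure_conj_genK x k : sigma_bar n x = 1 -> (x ^ gen k) ^ gen k = x.
Proof.
move=> xP; rewrite -conjgM; apply/conjg_fixP/commgP/pure_commute => //.
by rewrite gmulfM sigma_gen_sq.
Qed.

(* [arc i d] is the class of the pure braid generator A_(i, i+d+1). *)
Fixpoint arc i d : G :=
  if d is d'.+1 then arc i d' ^ gen (i + d) else gen i * gen i.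

Lemma arc0 i : arc i 0 = gen i * gen i.
Proof. by []. Qed.

Lemma arc_up i d : arc i d ^ gen (i + d.+1) = arc i d.+1.
Proof. by []. Qed.

Lemma arc_pure i d : sigma_bar n (arc i d) = 1.
Proof.
elim: d => [|d IHd]; first by rewrite arc0 gmulfM sigma_gen_sq.
by rewrite -arc_up gmulfJ IHd conj1g.
Qed.

Lemma gen_commute i j : (i.+1 < j) || (j.+1 < i) -> commute (gen i) (gen j).
Proof. by case/orP=> ij; [| symmetry]; apply: gen_comm. Qed.

Lemma conj_gen_far i j x : (i.+1 < j) || (j.+1 < i) ->
  (x ^ gen i) ^ gen j = (x ^ gen j) ^ gen i.
Proof. by move=> ij; rewrite -!conjgM (gen_commute ij). Qed.

Lemma arc_far i d k : (k.+1 < i) || (i + d.+1 < k) -> arc i d ^ gen k = arc i d.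
Proof.
elim: d => [|d IHd] ik /=.
  by apply/conjg_fixP/commgP/commute_sym/commuteM; apply: gen_commute; lia.
by rewrite conj_gen_far ?IHd //; lia.
Qed.

Lemma arc_grow_left k d : k.+1 < n.-1 -> arc k.+1 d ^ gen k = arc k d.+1.
Proof.
move=> kn; elim: d => [|d IHd] /=.
  (* By the braid relation [gen k.+1 * gen k] conjugates [gen k] to [gen k.+1]. So both sides of the
     goal agree after one more conjugation by [gen k], which is injective. *)
  have sE : gen k ^ (gen k.+1 * gen k) = gen k.+1.
    by apply: (mulgI (gen k.+1 * gen k)); rewrite -conjgC mulgA gen_braid.
  have := pure_conj_genK k (arc_pure k.+1 0); rewrite /= -[in RHS]sE -conjMg conjgM.
  by move/conjg_inj; rewrite addn1.
by rewrite conj_gen_far ?IHd ?addSnnS //; lia.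
Qed.

Lemma arc_down i d : arc i d.+1 ^ gen (i + d.+1) = arc i d.
Proof. by rewrite -arc_up pure_conj_genK ?arc_pure. Qed.

Lemma arc_shrink_left k d : k.+1 < n.-1 -> arc k d.+1 ^ gen k = arc k.+1 d.
Proof. by move=> kn; rewrite -arc_grow_left // pure_conj_genK ?arc_pure. Qed.

Lemma arc_inside i d k : i < k < i + d -> i + d < n.-1 -> arc i d ^ gen k = arc i d.
Proof.
elim/ltn_ind: d => -[|d] IHd ikd idn; first lia.
have [kd | kd] := ltnP k (i + d).
  by rewrite /= conj_gen_far ?IHd //; lia.
case: d => [|d] in IHd ikd idn kd *; first lia.
(* Now [gen k] and [gen k.+1] are the last two conjugators of the arc. The braid relation brings
   [gen k.+1] innermost, where it fixes the shorter arc. *)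
have -> : k = (i + d.+1)%N by lia.
rewrite -!arc_up (addnS i d.+1) -!conjgM mulgA -gen_braid; last lia.
rewrite -mulgA [LHS]conjgM (arc_far (k := (i + d.+1).+1)) //; lia.
Qed.

(** On the diagonal, truncated subtraction yields the junk value [arc i 0]. *)
Definition pair_gen i j : G := if i < j then arc i (j - i.+1) else arc j (i - j.+1).

Lemma pair_gen_pure i j : sigma_bar n (pair_gen i j) = 1.
Proof. by rewrite /pair_gen; case: ifP => _; apply: arc_pure. Qed.

Lemma pair_genC i j : pair_gen i j = pair_gen j i.
Proof. by rewrite /pair_gen; case: ltngtP => [||->]. Qed.

Lemma pair_gen_arc i d : pair_gen i (i + d.+1) = arc i d.
Proof. rewrite /pair_gen ifT; [congr arc|]; lia. Qed.

(** The position of [k] decides: moving one end lengthens or shortens the arc, exchanging two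
    adjacent ends fixes the square [arc i 0], and a generator outside or strictly inside the arc
    fixes it. *)
Lemma pair_gen_conj i j k : i < n -> j < n -> i != j -> k < n.-1 ->
  pair_gen i j ^ gen k = pair_gen (swap k i) (swap k j).
Proof.
wlog ij : i j / i < j => [main|].
  move=> iN jN ne kN; have [ij | ji] : i < j \/ j < i by lia.
    exact: main.
  by rewrite pair_genC [RHS]pair_genC main // eq_sym.
move=> iN jN _ kN.
have {ij} [d jE] : exists d, j = i + d.+1 by exists (j - i.+1)%N; lia.
rewrite {}jE in jN *; rewrite pair_gen_arc.
have [ki | ki] := eqVneq k.+1 i.
  rewrite -ki arc_grow_left; last lia.
  have -> : swap k k.+1 = k by rewrite /swap; split_eqs; lia.
  have -> : swap k (k.+1 + d.+1) = k + d.+2 by rewrite /swap; split_eqs; lia.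
  by rewrite pair_gen_arc.
have [ki2 | ki2] := eqVneq k i.
  rewrite -ki2; case: d jN => [|d] jN.
    have -> : swap k k = k + 1 by rewrite /swap; split_eqs; lia.
    have -> : swap k (k + 1) = k by rewrite /swap; split_eqs; lia.
    by rewrite pair_genC pair_gen_arc /= conjMg conjgE mulKg.
  have -> : swap k k = k.+1 by rewrite /swap; split_eqs; lia.
  have -> : swap k (k + d.+2) = k.+1 + d.+1 by rewrite /swap; split_eqs; lia.
  by rewrite pair_gen_arc arc_shrink_left //; lia.
have -> : swap k i = i by rewrite /swap; split_eqs; lia.
have [kj | kj] := eqVneq k (i + d.+1).
  have -> : swap k (i + d.+1) = i + d.+2 by rewrite /swap; split_eqs; lia.
  by rewrite pair_gen_arc kj arc_up.
have [kj1 | kj1] := eqVneq k.+1 (i + d.+1).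
  case: d => [|d] in jN kj kj1 *; first lia.
  have -> : swap k (i + d.+2) = i + d.+1 by rewrite /swap; split_eqs; lia.
  have -> : k = (i + d.+1)%N by lia.
  by rewrite pair_gen_arc arc_down.
have -> : swap k (i + d.+1) = i + d.+1 by rewrite /swap; split_eqs; lia.
rewrite pair_gen_arc; have [far | near] := boolP ((k.+1 < i) || (i + d.+1 < k)).
  exact: arc_far.
by apply: arc_inside; lia.
Qed.

Lemma wind_conj_gen x k (p q : 'I_n) : sigma_bar n x = 1 ->
  wind (x ^ gen k) p q = wind x (sigma_bar n (gen k) p) (sigma_bar n (gen k) q).
Proof.
move=> xP; rewrite conjgE !windM windV gmulfV sigma_genV xP !perm1.
by rewrite GRing.addrC GRing.addrK.
Qed.

Lemma wind_arc i d (p q : 'I_n) : i + d.+1 < n -> wind (arc i d) p q =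
  ((((p == i :> nat) && (q == i + d.+1 :> nat)) ||
   ((p == i + d.+1 :> nat) && (q == i :> nat))).*2)%:Z%R.
Proof.
elim: d p q => [|d IHd] p q idn.
  rewrite arc0 windM !wind_gen ?sigma_gen_swap; try lia.
  move: (p : nat) (q : nat) => {}p {}q.
  by rewrite -PoszD /crossing /swap; split_eqs; lia.
rewrite -arc_up wind_conj_gen ?arc_pure // IHd ?sigma_gen_swap; try lia.
move: (p : nat) (q : nat) => {}p {}q.
by rewrite /swap; split_eqs; lia.
Qed.

Lemma wind_pair_gen (i j p q : 'I_n) : i < j -> p < q ->
  wind (pair_gen i j) p q = ((p == i) && (q == j)).*2%:Z%R.
Proof.
move=> ij pq; have jn := ltn_ord j.
have -> : pair_gen i j = arc i (j - i.+1) by rewrite /pair_gen ij.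
rewrite wind_arc; last lia.
rewrite -!val_eqE /=; move: (p : nat) (q : nat) (i : nat) (j : nat) pq ij jn.
move=> {}p {}q {}i {}j pq ij jn.
by split_eqs; lia.
Qed.
End PureGenerators.

(** * The pure quotient: spanned by pair generators, detected by winding *)

Section PureQuotient.
Variable n : nat.
Local Notation G := (braid_mod_comm n).
Local Notation gen := (braid_gen n).
Implicit Types (x y z : G) (i j k : nat).

(** The kernel of [sigma_bar] as a type, to be written additively: integer combinations of pair
    generators then become sums, and [wind] an additive map. *)
Definition pure_quot : Type := {x : G | sigma_bar n x == 1}.
HB.instance Definition _ := Choice.on pure_quot.
HB.instance Definition _ := SubType.on pure_quot.
Implicit Types (a b : pure_quot).

Lemma pure_quotP a : sigma_bar n (val a) = 1.
Proof. exact/eqP/(valP a). Qed.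

Fact pure_add_subproof a b : sigma_bar n (val a * val b) == 1.
Proof. by rewrite gmulfM !pure_quotP mulg1. Qed.
Fact pure_opp_subproof a : sigma_bar n (val a)^-1 == 1.
Proof. by rewrite gmulfV pure_quotP invg1. Qed.
Fact pure_zero_subproof : sigma_bar n 1 == 1.
Proof. by rewrite gmulf1. Qed.

Definition pure_add a b : pure_quot :=
  exist (fun x : G => sigma_bar n x == 1) _ (pure_add_subproof a b).
Definition pure_opp a : pure_quot :=
  exist (fun x : G => sigma_bar n x == 1) _ (pure_opp_subproof a).
Definition pure_zero : pure_quot :=
  exist (fun x : G => sigma_bar n x == 1) _ pure_zero_subproof.

Fact pure_addA : associative pure_add.
Proof. by move=> a b c; apply: val_inj; apply: mulgA. Qed.
Fact pure_addC : commutative pure_add.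
Proof. by move=> a b; apply: val_inj; apply: pure_commute; apply: pure_quotP. Qed.
Fact pure_add0 : left_id pure_zero pure_add.
Proof. by move=> a; apply: val_inj; apply: mul1g. Qed.
Fact pure_addN : left_inverse pure_zero pure_opp pure_add.
Proof. by move=> a; apply: val_inj; apply: mulVg. Qed.

HB.instance Definition _ := GRing.isZmodule.Build pure_quot
  pure_addA pure_addC pure_add0 pure_addN.

Definition pure_wind (p q : 'I_n) a : int := wind (val a) p q.

Fact pure_wind_additive p q : GRing.zmod_morphism (pure_wind p q).
Proof.
move=> a b; rewrite /pure_wind [val _]/(val a * (val b)^-1) windM windV.
by rewrite pure_quotP gmulfV pure_quotP invg1 !perm1.
Qed.
HB.instance Definition _ p q :=
  GRing.isZmodMorphism.Build pure_quot int (pure_wind p q) (pure_wind_additive p q).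

Definition pair_pure (p : 'I_n * 'I_n) : pure_quot :=
  exist (fun x : G => sigma_bar n x == 1) _ (introT eqP (pair_gen_pure n p.1 p.2)).

Definition pure_comb (v : 'I_n -> 'I_n -> int) : pure_quot :=
  (\sum_(p : 'I_n * 'I_n | (p.1 < p.2)%N) pair_pure p *~ v p.1 p.2)%R.

Lemma wind_pure_comb v (i j : 'I_n) : i < j ->
  wind (val (pure_comb v)) i j = (2 * v i j)%R.
Proof.
move=> ij; rewrite -[LHS]/(pure_wind i j _).
have pairE (p : 'I_n * 'I_n) : p.1 < p.2 ->
    pure_wind i j (pair_pure p) = ((i == p.1) && (j == p.2)).*2%:Z%R.
  by move=> pl; apply: wind_pair_gen.
have -> : pure_wind i j (pure_comb v) = (\sum_(p : 'I_n * 'I_n | (p.1 < p.2)%N)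
    ((i == p.1) && (j == p.2)).*2%:Z *~ v p.1 p.2)%R.
  rewrite /pure_comb GRing.raddf_sum; apply: eq_bigr => p pl.
  by rewrite -pairE //; apply: raddfMz.
rewrite (bigD1 (i, j)) //= big1 ?GRing.addr0 => [|p /andP[pl pne]].
  by rewrite !eqxx mulrzz.
suff -> : (i == p.1) && (j == p.2) = false by rewrite mul0rz.
by apply: contraNF pne => /andP[/eqP-> /eqP->]; rewrite -surjective_pairing.
Qed.

Definition pair_gens : set G :=
  fun x => exists p q : 'I_n, p < q /\ x = pair_gen n p q.

Definition pure_span : {pred G} := fun x => `[< Defs.generated pair_gens x >].

Fact pure_spanM : mulg_closed pure_span.
Proof. by move=> x y /asboolP gx /asboolP gy; apply/asboolP/generatedM. Qed.
Fact pure_span1 : 1 \in pure_span.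
Proof. exact/asboolP/generated1. Qed.
Fact pure_spanV : invg_closed pure_span.
Proof. by move=> x /asboolP gx; apply/asboolP/generatedV. Qed.

Lemma pure_spanP x : x \in pure_span -> exists v, x = val (pure_comb v).
Proof.
move/asboolP; elim=> {x} [_ [i [j [ij ->]]]| |x y _ [v ->] _ [w ->]|x _ [v ->]].
- exists (fun p q => ((p == i) && (q == j))%:Z%R).
  rewrite -[LHS]/(val (pair_pure (i, j))); congr val.
  rewrite /pure_comb (bigD1 (i, j)) // big1 => [|p /andP[_ pne]].
    by rewrite /= !eqxx GRing.addr0.
  suff -> : (p.1 == i) && (p.2 == j) = false by [].
  by apply: contraNF pne => /andP[/eqP<- /eqP<-]; rewrite -surjective_pairing.
- by exists (fun _ _ => 0%R); rewrite /pure_comb big1.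
- exists (fun p q => (v p q + w p q)%R).
  rewrite -[LHS]/(val (pure_comb v + pure_comb w)%R); congr val.
  by rewrite -big_split; apply: eq_bigr => p _; rewrite mulrzDr.
- exists (fun p q => (- v p q)%R).
  rewrite -[LHS]/(val (- pure_comb v)%R); congr val.
  by rewrite -GRing.sumrN; apply: eq_bigr => p _; rewrite mulrNz.
Qed.

Lemma pure_span_pure x : x \in pure_span -> sigma_bar n x = 1.
Proof. by case/pure_spanP=> v ->; apply: pure_quotP. Qed.

Lemma pair_gen_span (i j : nat) : i < n -> j < n -> i != j ->
  pair_gen n i j \in pure_span.
Proof.
wlog ij : i j / i < j => [main|].
  move=> iN jN ne; have [ij | ji] : i < j \/ j < i by lia.
    exact: main.
  by rewrite pair_genC main // eq_sym.
move=> iN jN _; apply/asboolP/generated_mem.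
by exists (Ordinal iN), (Ordinal jN).
Qed.

Lemma pure_span_conj_gen k x : k < n.-1 -> x \in pure_span -> x ^ gen k \in pure_span.
Proof.
move=> kn /asboolP; elim=> {x} [_ [i [j [ij ->]]]| |x y _ xP _ yP|x _ xP].
- have ne : swap k i != swap k j by rewrite (inj_eq (inv_inj (@swapK k))); lia.
  have lt_swap (p : 'I_n) : swap k p < n by rewrite -sigma_gen_swap.
  by rewrite pair_gen_conj ?pair_gen_span //; lia.
- by rewrite conj1g pure_span1.
- by rewrite conjMg pure_spanM.
- by rewrite conjVg pure_spanV.
Qed.

Fact pure_spanJ x y : x \in pure_span -> x ^ y \in pure_span.
Proof.
suff: (forall z, z \in pure_span -> z ^ y \in pure_span) /\
      (forall z, z \in pure_span -> z ^ y^-1 \in pure_span) by case=> + _; apply.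
elim/gen_ind: y => [|k kn|y z [yP yVP] [zP zVP]|y [yP yVP]].
- by split=> z; rewrite ?invg1 conjg1.
- split=> z zP; first exact: pure_span_conj_gen.
  (* Squares of generators are pure, so they centralise [pure_span]. *)
  rewrite -[z](pure_conj_genK k (pure_span_pure zP)) conjgK.
  exact: pure_span_conj_gen.
- by split=> t tP; rewrite ?invgM conjgM; [apply/zP/yP | apply/yVP/zVP].
- by rewrite invgK.
Qed.

HB.instance Definition _ := isMulClosed.Build G pure_span pure_spanM.
HB.instance Definition _ := isMul1Closed.Build G pure_span pure_span1.
HB.instance Definition _ := isInvClosed.Build G pure_span pure_spanV.
HB.instance Definition _ := isConjgClosed.Build G pure_span pure_spanJ.

Local Notation piQ := (\pi_(quot (pure_span : normalClosed G))%qT).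
Let Q : groupType := quot (pure_span : normalClosed G).
Let t k : Q := piQ (gen k).
Let tau : UMagmaMorphism.type Q 'S_n := quot_lift pure_span_pure.

(** Modulo [pure_span] the generators become involutions, since their squares are pair generators.
    They thus satisfy the Coxeter relations, and [coxeter_faithful] applies to the quotient. *)
Lemma pure_in_span x : sigma_bar n x = 1 -> x \in pure_span.
Proof.
move=> xP; suff: piQ x = 1 :> Q.
  by rewrite -[1]/(piQ 1); move/esym/quot_eqP; rewrite invg1 mul1g.
have piM y z : piQ (y * z) = piQ y * piQ z :> Q by exact: pi_quotM.
have piV y : piQ y^-1 = (piQ y)^-1 :> Q by exact: pi_quotV.
have t_sq i : i < n.-1 -> t i * t i = 1.
  move=> iN; rewrite /t -piM; apply/esym/quot_eqP; rewrite invg1 mul1g.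
  rewrite -arc0 -pair_gen_arc pair_gen_span //; lia.
have t_comm i j : i.+1 < j -> t i * t j = t j * t i.
  by move=> ij; rewrite /t -!piM gen_comm.
have t_braid i : i.+1 < n.-1 -> t i.+1 * t i * t i.+1 = t i * t i.+1 * t i.
  move/gen_braid/(congr1 piQ).
  by rewrite (piM (_ * _)) (piM (gen _)) (piM (_ * _)) (piM (gen _)).
have tauE y : tau (piQ y) = sigma_bar n y.
  exact: (quot_lift_pi pure_span_pure).
have tau_t k (p : 'I_n) : k < n.-1 -> tau (t k) p = swap k p :> nat.
  by move=> kn; rewrite /t tauE sigma_gen_swap.
(* Positive words suffice because each [t k] is an involution: an inverse is the reversed word. *)
have [u un uE] : exists2 u : seq nat, all (ltn^~ n.-1) u &
    piQ x = \prod_(k <- u) t k :> Q.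
  elim/gen_ind: x {xP} => [|k kn|y z [u un uE] [v vn vE]|y [u un uE]].
  - by exists [::]; rewrite ?big_nil.
  - by exists [:: k]; rewrite /= ?kn ?big_seq1.
  - by exists (u ++ v); rewrite ?all_cat ?un // piM uE vE big_cat.
  - exists (rev u); rewrite ?all_rev // piV uE.
    elim: u un {uE} => [|k u IHu] /=; first by rewrite big_nil invg1.
    case/andP=> kn /IHu uE.
    rewrite big_cons invgM uE (mulg1_eq (t_sq k kn)).
    by rewrite rev_cons -cats1 big_cat big_seq1.
rewrite uE; apply: (coxeter_faithful t_sq t_comm t_braid tau_t) => //.
by rewrite -uE tauE.
Qed.

(** The windings of a combination of pair generators are twice its coefficients, so if they vanish,
    the combination is zero. *)
Lemma wind_faithful x : sigma_bar n x = 1 ->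
  (forall i j : 'I_n, i < j -> wind x i j = 0%R) -> x = 1.
Proof.
move=> /pure_in_span/pure_spanP[v ->] x0.
have v0 (i j : 'I_n) : i < j -> v i j = 0%R.
  by move=> ij; have := x0 i j ij; rewrite wind_pure_comb //; lia.
by rewrite /pure_comb big1 // => p pl; rewrite v0.
Qed.
End PureQuotient.

(** * Orders of torsion elements *)

Section Torsion.
Variable n : nat.
Local Notation G := (braid_mod_comm n).
Local Notation gen := (braid_gen n).
Implicit Types (x y z : G) (theta : 'S_n).

(** On pure elements [wind] is additive with values in the integers, so [m] times each winding of
    [x] is zero. *)
Lemma pure_torsion_free x m :
  sigma_bar n x = 1 -> 0 < m -> x ^+ m = 1 -> x = 1.
Proof.
move=> xP m_gt0 xm; apply: wind_faithful => // i j _.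
have windX k : wind (x ^+ k) i j = (wind x i j *+ k)%R.
  elim: k => [|k IHk]; first by rewrite wind1.
  by rewrite expgS windM xP !perm1 IHk GRing.mulrS.
have /eqP := windX m; rewrite xm wind1 eq_sym Num.Theory.mulrn_eq0.
by rewrite -leqn0 leqNgt m_gt0 => /eqP.
Qed.

Lemma sigma_bar_involution x : x * x = 1 -> sigma_bar n x = 1.
Proof.
move=> xx; apply/permP=> i; rewrite perm1; apply/eqP; apply/negP=> /negP ij.
set j := sigma_bar n x i in ij.
have jE : sigma_bar n x j = i by rewrite /j -permM -gmulfM xx gmulf1 perm1.
(* Symmetry turns the cocycle identity into [0 = wind x j i + wind x j i]. A zero winding is even,
   yet [x] reverses the order of the two strands. *)
have := windM x x i j; rewrite xx wind1 -/j jE wind_sym => w0.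
have := wind_parity x ij; rewrite jE -/j.
have -> : wind x j i = 0%R by lia.
by case: ltngtP ij => // /val_inj ->; rewrite eqxx.
Qed.

(** If [s] is the order of the image, [x ^+ s] is a pure torsion element, hence trivial, and
    minimality of [r] gives [r <= s]. *)
Lemma has_order_sigma_bar x r : has_order x r -> #[sigma_bar n x] = r.
Proof.
case=> r_gt0 xr xm; set s := #[_].
have xs : x ^+ s = 1.
  apply: (pure_torsion_free _ r_gt0); first by rewrite gmulfXn expg_order.
  by rewrite -expgnA mulnC expgnA xr expg1n.
have s_gt0 : 0 < s by apply: order_gt0.
have sr : s %| r by rewrite order_dvdn -gmulfXn xr gmulf1.
apply/eqP; rewrite eqn_leq dvdn_leq // leqNgt; apply/negP=> sr'.
by apply: (xm s) => //; rewrite s_gt0.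
Qed.

(** For even [r] the square of [x ^+ r./2] is 1, so its image is trivial, although the image of [x]
    has order [r]. *)
Lemma has_order_odd x r : has_order x r -> odd r.
Proof.
move=> xr; have sE := has_order_sigma_bar xr; case: xr => r_gt0 xr xm.
apply/negPn/negP=> r_even; have rE : r = (r./2 + r./2)%N by lia.
have := @sigma_bar_involution (x ^+ r./2).
rewrite -expgnDr -rE => /(_ xr)/eqP; rewrite gmulfXn -order_dvdn sE => /dvdn_leq; lia.
Qed.

Lemma sigma_bar_gen (i j : 'I_n) : j = i.+1 :> nat -> sigma_bar n (gen i) = tperm i j.
Proof.
move=> jE; have iN : i < n.-1 by have := ltn_ord j; lia.
rewrite (gen_ord (Ordinal iN)) sigma_bar_pi sigma_gen.
by congr tperm; apply: val_inj.
Qed.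

Lemma sigma_bar_surj theta : exists x, sigma_bar n x = theta.
Proof.
have lift d (i j : 'I_n) : j = (i + d.+1)%N :> nat ->
    exists x, sigma_bar n x = tperm i j.
  elim: d j => [|d IHd] j jE.
    by exists (gen i); apply: sigma_bar_gen; rewrite jE addn1.
  have j'n : i + d.+1 < n by have := ltn_ord j; lia.
  have [x xE] := IHd (Ordinal j'n) erefl.
  exists (x ^ gen (Ordinal j'n)).
  rewrite gmulfJ xE (sigma_bar_gen (j := j)) ?jE ?addnS // tpermJ tpermL tpermD //.
    by rewrite -val_eqE /=; lia.
  by rewrite -val_eqE /=; lia.
have lift_tperm (i j : 'I_n) : i != j -> exists x, sigma_bar n x = tperm i j.
  rewrite -val_eqE neq_ltn => /orP[] /= ij.
    by apply: (lift (j - i.+1)%N); lia.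
  by rewrite tpermC; apply: (lift (i - j.+1)%N); lia.
have [ts -> ] := prod_tpermP theta.
elim: ts => [|t ts IHts]; first by exists 1; rewrite big_nil gmulf1.
case/andP=> tP /IHts[x xE]; have [y yE] := lift_tperm _ _ tP.
by exists (y * x); rewrite big_cons gmulfM xE yE.
Qed.

(** Even powers of [theta] fix [i], so the odd power [theta ^+ #[theta]], which is the identity,
    sends [i] to [j]. *)
Lemma odd_order_no_swap theta (i j : 'I_n) : odd #[theta] ->
  theta i = j -> theta j = i -> i = j.
Proof.
move=> oddt ij ji.
have even_fix m : (theta ^+ m.*2) i = i.
  elim: m => [|m IHm]; first by rewrite perm1.
  by rewrite doubleS !expgSr !permM IHm ij ji.
have := perm1 i; rewrite -{1}(expg_order theta) -(odd_double_half #[theta]) oddt.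
by rewrite add1n expgSr permM even_fix ij.
Qed.

(** * Lifting a permutation of odd order *)

Section OddLift.
Variable theta : 'S_n.
Hypothesis theta_odd : odd #[theta].

Let act (p : 'I_n * 'I_n) := (theta p.1, theta p.2).

Let act_inj : injective act.
Proof. by move=> [i j] [k l] [/perm_inj-> /perm_inj->]. Qed.

(** An arbitrary numbering of the orbits of [theta] on ordered pairs. Comparing the numbers of
    [(i, j)] and [(j, i)] gives the invariant orientation. *)
Let rank p : nat := enum_rank (froot act p).

Let rank_act p : rank (act p) = rank p.
Proof.
rewrite /rank; congr (nat_of_ord (enum_rank _)).
by apply/eqP; rewrite (root_connect (fconnect_sym act_inj)) fconnect_sym ?fconnect1.
Qed.

Let oriented i j := rank (i, j) < rank (j, i).

Let oriented_act i j : oriented (theta i) (theta j) = oriented i j.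
Proof. by rewrite /oriented -(rank_act (i, j)) -(rank_act (j, i)). Qed.

(** If [(i, j)] and [(j, i)] had the same rank, they would share an orbit, so some power of [theta]
    would exchange [i] and [j]; that power has odd order too. *)
Let orientedC i j : i != j -> oriented i j = ~~ oriented j i.
Proof.
move=> ij; rewrite /oriented -leqNgt ltn_neqAle andbC -[RHS]andbT; congr andb.
apply: contra_neq ij => /val_inj/enum_rank_inj/eqP.
rewrite (root_connect (fconnect_sym act_inj)) => /iter_findex.
set m := findex _ _ _ => mE.
have iterE k : iter k act (i, j) = ((theta ^+ k) i, (theta ^+ k) j).
  by elim: k => [|k IHk]; rewrite ?perm1 // iterS IHk expgSr !permM.
move: mE; rewrite iterE => -[ij ji].
apply: (@odd_order_no_swap (theta ^+ m)) => //.
exact: dvdn_odd (orderXdvd _ _) theta_odd.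
Qed.

(** The function f on unordered pairs: 1 when the invariant orientation is increasing, 0
    otherwise. *)
Let potential (i j : 'I_n) : int := if oriented i j then (i < j) else (j < i).

Let potentialC i j : potential i j = potential j i.
Proof.
have [->//|ij] := eqVneq i j.
by rewrite /potential orientedC //; case: (oriented j i).
Qed.

Let target (i j : 'I_n) := (potential (theta i) (theta j) - potential i j)%R.

Let lift_wind : exists x, sigma_bar n x = theta /\ forall i j, wind x i j = target i j.
Proof.
have [x xE] := sigma_bar_surj theta.
(* A pure factor on the left shifts the windings by twice its coefficients, so half the defect of an
   arbitrary lift [x] corrects it. *)
exists (val (pure_comb (fun i j => ((target i j - wind x i j)%R %/ 2)%Z)) * x).
rewrite gmulfM pure_quotP mul1g; split=> // i j.
wlog ij : i j / i < j => [main|].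
  have [ij|ji|/val_inj->] := ltngtP i j; first exact: main.
    by rewrite wind_sym main // /target potentialC [potential i j]potentialC.
  by rewrite wind_diag /target /potential !ltnn !if_same.
rewrite windM wind_pure_comb // pure_quotP !perm1.
have ne : i != j by rewrite -val_eqE /= ltn_eqF.
(* As [theta] preserves the orientation, [target i j] is odd exactly when [theta] reverses the order
   of [i] and [j], just like [wind x i j]. So the division by 2 is exact. *)
have := wind_parity x ne; rewrite xE /target /potential oriented_act ij.
have : theta i != theta j by rewrite (inj_eq perm_inj).
rewrite -val_eqE /=.
case: (oriented i j); case: ltngtP => //=; lia.
Qed.

Lemma odd_order_lift : exists beta, has_order beta #[theta] /\ sigma_bar n beta = theta.
Proof.
have [x [xE xw]] := lift_wind; exists x; split=> //.
(* The windings of the powers telescope, so they vanish once [theta ^+ m = 1]. *)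
have xmw m i j : wind (x ^+ m) i j =
    (potential ((theta ^+ m)%g i) ((theta ^+ m)%g j) - potential i j)%R.
  elim: m i j => [|m IHm] i j; first by rewrite wind1 !perm1 GRing.subrr.
  rewrite !expgS windM IHm xw xE !permM /target.
  by rewrite GRing.addrC GRing.addrA GRing.subrK.
split=> [||m mr].
- exact: order_gt0.
- apply: wind_faithful => [|i j _]; first by rewrite gmulfXn xE expg_order.
  by rewrite xmw expg_order !perm1 GRing.subrr.
- move/(congr1 (sigma_bar n)); rewrite gmulfXn xE gmulf1 => /eqP.
  by rewrite -order_dvdn => /dvdn_leq; lia.
Qed.
End OddLift.
End Torsion.

(** * The finite cyclic group generated by a torsion element *)

Section Powers.
Variables (G : groupType) (x : G) (r : nat).
Hypothesis xr : has_order x r.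

(* The unused argument lets the closure under inverses, which needs a finite
   order, be found as an instance. *)
Definition powers of has_order x r : {pred G} := fun y => `[< exists m, y = x ^+ m >].

Fact powersM : mulg_closed (powers xr).
Proof.
move=> _ _ /asboolP[k ->] /asboolP[m ->]; apply/asboolP.
by exists (k + m)%N; rewrite expgnDr.
Qed.
Fact powers1 : 1 \in powers xr.
Proof. by apply/asboolP; exists 0. Qed.
Fact powersV : invg_closed (powers xr).
Proof.
(* The exponents [m] and [m * r.-1] add up to a multiple of [r]. *)
move=> _ /asboolP[m ->]; apply/asboolP; exists (m * r.-1)%N.
case: xr => r_gt0 xr1 _; apply: mulg1_eq.
by rewrite -expgnDr -mulnS prednK // mulnC expgnA xr1 expg1n.
Qed.
HB.instance Definition _ := isMulClosed.Build G (powers xr) powersM.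
HB.instance Definition _ := isMul1Closed.Build G (powers xr) powers1.
HB.instance Definition _ := isInvClosed.Build G (powers xr) powersV.

Lemma powers_finite : finite_set [set` powers xr]%classic.
Proof.
apply: (@sub_finite_set _ _ [set` [seq x ^+ m | m <- iota 0 r]]%classic); last first.
  exact: finite_seq.
move=> _ /asboolP[m ->] /=; apply/mapP; exists (m %% r)%N.
  by rewrite mem_iota /= ltn_mod; case: xr.
rewrite {1}(divn_eq m r) expgnDr mulnC expgnA.
by case: xr => _ -> _; rewrite expg1n mul1g.
Qed.
End Powers.

Theorem corollary4 (n : nat) (hn : 3 <= n) :
  [/\ torsion_orders (braid_mod_comm n) =
        [set r | odd r /\ exists theta : 'S_n, #[theta]%g = r]%classic,
      forall (theta : 'S_n) (r : nat), odd r -> #[theta]%g = r ->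
        exists beta : braid_mod_comm n,
          has_order beta r /\ sigma_bar n beta = theta
    & forall (H : {group 'S_n}) (r : nat), cyclic H -> odd r -> #|H| = r ->
        exists Ht : groupClosed (braid_mod_comm n),
          finite_set [set` Ht]%classic /\
          (sigma_bar n @` [set` Ht] = [set` H])%classic].
Proof.
have lift (theta : 'S_n) r : odd r -> #[theta]%g = r ->
    exists beta : braid_mod_comm n, has_order beta r /\ sigma_bar n beta = theta.
  by move=> r_odd tr; rewrite -tr; apply: odd_order_lift; rewrite tr.
split=> //.
- apply/seteqP; split=> r /=.
    case=> x xr; split; first exact: has_order_odd xr.
    by exists (sigma_bar n x); apply: has_order_sigma_bar.
  by case=> r_odd [theta /(lift _ _ r_odd)[x [xr _]]]; exists x.
- move=> H r /cyclicP[theta ->] r_odd tr.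
  have [beta [betar betaE]] := lift _ _ r_odd tr.
  (* The lift [beta] of a generator [theta] of the cyclic group suffices, as powers of [beta] map to
     the same powers of [theta]. *)
  exists (powers betar : groupClosed _); split; first exact: powers_finite.
  have betaX m : sigma_bar n (beta ^+ m) = theta ^+ m by rewrite gmulfXn betaE.
  apply/seteqP; split=> [_ [_ /asboolP[m ->] <-]|_ /cycleP[m ->]].
    by rewrite betaX; apply: mem_cycle.
  by exists (beta ^+ m) => //; apply/asboolP; exists m.
Qed.
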